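(* Let $G = A\rtimes(\langle\tau_1\rangle\times\cdots\times\langle\tau_r\rangle)$, $n_s$, $\psi_s$, $u_s$, $m_s$, $k_s=1+u_sp_s^{m_s}$, $\epsilon_s$ $(1\le s\le r)$ and the bijection $\pi:G\to G$, $\pi(a\tau_1^{i_1}\cdots\tau_r^{i_r}) = a\tau_1^{S(k_1,i_1)}\cdots\tau_r^{S(k_r,i_r)}$ (with $a\in A$ and $i_1,\dots,i_r\ge 0$) be as in the context. For $\theta\in\mathrm{Aut}(G)$ and $1\le s\le r$ write $\theta(\tau_s)=c_s\tau_s^{\theta_s}$ with $c_s\in A$ and $\theta_s\in\mathbb{Z}$. Suppose that (1) $A$ has finite exponent coprime to $p_1,\dots,p_r$; (2) $\psi_s$ has order dividing $p_s^{m_s}$ for all $1\le s\le r$; (3) $\theta_s\equiv 1\pmod{p_s^{n_s-m_s+\epsilon_s}}$ for all $\theta\in\mathrm{Aut}(G)$ and all $1\le s\le r$. Then $\pi\in\mathrm{NHol}(G)$. If in addition (4) $n_s\le 2m_s-\epsilon_s$ for all $1\le s\le r$, then the coset $\pi\,\mathrm{Hol}(G)$ has order $p_1^{n_1-m_1}\cdots p_r^{n_r-m_r}$ in $T(G)$.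
   Context: Holomorphs: for a group $G$, $\mathrm{Perm}(G)$ is the group of all permutations of the set $G$; $\rho:G\to\mathrm{Perm}(G)$, $\rho(\sigma)=(x\mapsto x\sigma^{-1})$, is the right regular representation; $\mathrm{Hol}(G)=\rho(G)\rtimes\mathrm{Aut}(G)\le\mathrm{Perm}(G)$ is the holomorph; $\mathrm{NHol}(G)$ is the normalizer of $\mathrm{Hol}(G)$ in $\mathrm{Perm}(G)$; and $T(G)=\mathrm{NHol}(G)/\mathrm{Hol}(G)$. Setting: $\mathbb{N}$ denotes the positive integers. $A$ is a group, $d=p_1^{n_1}\cdots p_r^{n_r}$ with $p_1,\dots,p_r$ distinct primes and $n_1,\dots,n_r\in\mathbb{N}$, and $G=A\rtimes C_d$ with $C_d$ cyclic of order $d$, written as $G=A\rtimes(\langle\tau_1\rangle\times\cdots\times\langle\tau_r\rangle)$, where $\tau_s$ has order $p_s^{n_s}$. For $1\le s\le r$, $\psi_s\in\mathrm{Aut}(A)$ is the automorphism with $\tau_s a\tau_s^{-1}=\psi_s(a)$ for all $a\in A$. For each $s$ fix $u_s,m_s\in\mathbb{N}$ with $p_s\nmid u_s$ and $m_s\le n_s$, and with $m_s\ge 2$ if $p_s=2$; put $k_s=1+u_sp_s^{m_s}$. Put $\epsilon_s=1$ if $p_s=2$ and $\epsilon_s=0$ if $p_s$ is odd. For $x\in\mathbb{N}$ and an integer $i\ge 0$, $S(x,i)=1+x+\cdots+x^{i-1}$, with $S(x,0)=0$. The map $\pi:G\to G$, $\pi(a\tau_1^{i_1}\cdots\tau_r^{i_r})=a\tau_1^{S(k_1,i_1)}\cdots\tau_r^{S(k_r,i_r)}$,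 where $a\in A$ and the exponents $i_1,\dots,i_r$ are taken to be non-negative integers, is a well-defined bijection. Under condition (1), every $\theta\in\mathrm{Aut}(G)$ satisfies $\theta(\tau_s)=c_s\tau_s^{\theta_s}$ for some $c_s\in A$ and $\theta_s\in\mathbb{Z}$, with $\theta_s$ determined modulo $p_s^{n_s}$. *)

(* Defs.v *)
From HB Require Import structures.
From mathcomp Require Import all_boot all_order all_algebra.
From mathcomp Require Import boolp classical_sets.

Set Implicit Arguments.
Unset Strict Implicit.
Unset Printing Implicit Defensive.

Local Open Scope group_scope.

(* Groups are MathComp's possibly infinite [groupType]s, and subgroups are its
   bundled boolean predicates [groupClosed G]; classical predicates are turned
   into boolean ones with boolp's `[< _ >]. *)

Definition expgz (G : groupType) (x : G) (z : int) : G :=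
  match z with Posz n => x ^+ n | Negz n => x ^- n.+1 end.

Definition has_order (G : groupType) (x : G) (n : nat) : Prop :=
  [/\ (0 < n)%N, x ^+ n = 1 &
      forall k, (0 < k)%N -> x ^+ k = 1 -> (n <= k)%N].

Definition has_exponent (G : groupType) (e : nat) : Prop :=
  [/\ (0 < e)%N, forall x : G, x ^+ e = 1 &
      forall k, (0 < k)%N -> (forall x : G, x ^+ k = 1) -> (e <= k)%N].

Definition cyc (G : groupType) (x : G) : {pred G} :=
  [pred y | `[< exists z : int, y = expgz x z >] ].

Definition subgrp (G : groupType) (A : groupClosed G) := {x : G | x \in A}.

HB.instance Definition _ (G : groupType) (A : groupClosed G) :=
  [isSub for @sval G (fun x => x \in A) : subgrp A -> G].
HB.instance Definition _ (G : groupType) (A : groupClosed G) :=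
  [Choice of subgrp A by <:].

Fact subgrp_closed (G : groupType) (A : groupClosed G) :
  group_closed (fun x : G => x \in A).
Proof. by split; [exact: gpred1 | move=> x y xA yA; exact: gpredF]. Qed.

HB.instance Definition _ (G : groupType) (A : groupClosed G) :=
  SubChoice_isSubGroup.Build G _ (subgrp A) (@subgrp_closed G A).

(* G is the internal semidirect product A ><| C, with A normal. *)
Definition is_sdprod (G : groupType) (A C : groupClosed G) : Prop :=
  [/\ {in A, forall a (g : G), a ^ g \in A},
      forall g : G, exists a c, [/\ a \in A, c \in C & g = a * c] &
      forall x, x \in A -> x \in C -> x = 1].

(* C is the internal direct product of the H s. *)
Definition is_dprod (G : groupType) (r : nat) (C : groupClosed G)
    (H : 'I_r -> {pred G}) : Prop :=
  [/\ forall s t x y, s != t -> x \in H s -> y \in H t -> commute x y,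
      forall h, (forall s, h s \in H s) -> \prod_(s < r) h s \in C,
      forall c, c \in C ->
        exists h, (forall s, h s \in H s) /\ c = \prod_(s < r) h s &
      forall h h', (forall s, h s \in H s) -> (forall s, h' s \in H s) ->
        \prod_(s < r) h s = \prod_(s < r) h' s -> forall s, h s = h' s].

Record Perm (T : Type) := MkPerm { pfun :> T -> T; pbij : bijective pfun }.

Section Perm.
Context {T : Type}.
Implicit Types f g h : Perm T.

Lemma permP f g : (forall x, f x = g x) -> f = g.
Proof.
case: f g => [f fb] [g gb] /= /funext E; rewrite E in fb *.
by congr MkPerm; exact: Prop_irrelevance.
Qed.

HB.instance Definition _ := gen_eqMixin (Perm T).
HB.instance Definition _ := gen_choiceMixin (Perm T).

Definition perm1 : Perm T :=
  MkPerm (@Bijective _ _ idfun idfun (frefl _) (frefl _)).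
Definition permM f g : Perm T := MkPerm (bij_comp (pbij f) (pbij g)).

Fact perm_inv_ex f : exists g, cancel f g /\ cancel g f.
Proof. by case: (pbij f) => g fK gK; exists (MkPerm (Bijective gK fK)). Qed.

Definition permV f : Perm T := sval (cid (perm_inv_ex f)).

Lemma permVK f : cancel (permV f) f.
Proof. by case: (svalP (cid (perm_inv_ex f))). Qed.

Lemma permKV f : cancel f (permV f).
Proof. by case: (svalP (cid (perm_inv_ex f))). Qed.

Fact permMA : associative permM. Proof. by move=> f g h; exact: permP. Qed.
Fact perm1M : left_id perm1 permM. Proof. by move=> f; exact: permP. Qed.
Fact permM1 : right_id perm1 permM. Proof. by move=> f; exact: permP. Qed.
Fact permVM : left_inverse perm1 permV permM.
Proof. by move=> f; apply: permP => x; exact: permKV. Qed.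
Fact permMV : right_inverse perm1 permV permM.
Proof. by move=> f; apply: permP => x; exact: permVK. Qed.

HB.instance Definition _ :=
  isGroup.Build (Perm T) permMA perm1M permM1 permVM permMV.

End Perm.

(* Unlike MathComp's {perm T}, products compose from right to left. *)
Lemma permME T (f g : Perm T) x : (f * g) x = f (g x).
Proof. by []. Qed.

Lemma perm1E T (x : T) : (1 : Perm T) x = x.
Proof. by []. Qed.

Section Normaliser.
Context {K : groupType}.
Implicit Types (H : groupClosed K) (g x : K) (X Y : set K).

Definition normaliser H : {pred K} :=
  [pred g | `[< forall x, (g * x * g^-1 \in H) = (x \in H) >] ].

Lemma normaliserP H g :
  reflect (forall x, (g * x * g^-1 \in H) = (x \in H)) (g \in normaliser H).
Proof. exact: asboolP. Qed.

Section Closed.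
Variable H : groupClosed K.

Fact normaliser1 : 1 \in normaliser H.
Proof. by apply/normaliserP => x; rewrite invg1 mulg1 mul1g. Qed.

Fact normaliserM : mulg_closed (normaliser H).
Proof.
move=> f g /normaliserP fN /normaliserP gN; apply/normaliserP => x.
by rewrite -(gN x) -(fN (g * x * g^-1)) invgM !mulgA.
Qed.

Fact normaliserV : invg_closed (normaliser H).
Proof.
move=> g /normaliserP gN; apply/normaliserP => x.
by rewrite -(gN (_ * _)) !mulgA invgK mulgV mul1g mulgK.
Qed.

HB.instance Definition _ := isMulClosed.Build K (normaliser H) normaliserM.
HB.instance Definition _ := isMul1Closed.Build K (normaliser H) normaliser1.
HB.instance Definition _ := isInvClosed.Build K (normaliser H) normaliserV.

End Closed.

Definition lcoset g H : set K := [set g * h | h in [set` H]]%classic.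

(* The elements of N(H) / H are the cosets g H with g in N(H), multiplied and
   inverted as subsets of K. *)
Record quot H := MkQuot {
  qset :> set K;
  qsetP : exists2 g, g \in normaliser H & qset = lcoset g H }.

Section Quot.
Variable H : groupClosed K.
Implicit Types q : quot H.

Lemma quot_inj q q' : qset q = qset q' -> q = q'.
Proof.
case: q q' => [X XP] [Y YP] /= E; rewrite E in XP *.
by congr MkQuot; exact: Prop_irrelevance.
Qed.

HB.instance Definition _ := gen_eqMixin (quot H).
HB.instance Definition _ := gen_choiceMixin (quot H).

Definition coset g (gN : g \in normaliser H) : quot H :=
  MkQuot (ex_intro2 _ _ g gN erefl).

Definition mulset X Y : set K := [set x * y | x in X & y in Y]%classic.
Definition invset X : set K := [set x^-1 | x in X]%classic.

Lemma lcosetM f g : g \in normaliser H ->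
  mulset (lcoset f H) (lcoset g H) = lcoset (f * g) H.
Proof.
move=> /normaliserP gN; apply/seteqP; split=> x.
  move=> [_ [a aH <-]] [_ [b bH <-] <-] /=.
  exists (g^-1 * a * g * b); last by rewrite !mulgA mulgK.
  by rewrite /= gpredM // -gN !mulgA mulgV mul1g mulgK.
move=> [a aH <-]; exists f; first by exists 1; rewrite ?mulg1 //= gpred1.
by exists (g * a); [exists a | rewrite mulgA].
Qed.

Lemma lcosetV g : g \in normaliser H -> invset (lcoset g H) = lcoset g^-1 H.
Proof.
move=> /normaliserP gN; apply/seteqP; split=> x.
  move=> [_ [a aH <-] <-]; exists (g * a^-1 * g^-1).
    by rewrite /= gN gpredVr.
  by rewrite !mulgA mulVg mul1g invgM.
move=> [a aH <-]; exists (a^-1 * g); last by rewrite invgM invgK.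
exists (g^-1 * a^-1 * g); last by rewrite !mulgA mulgV mul1g.
by rewrite /= -gN !mulgA mulgV mul1g mulgK gpredVr.
Qed.

Fact quotM_subproof q q' :
  exists2 g, g \in normaliser H & mulset q q' = lcoset g H.
Proof.
case: q q' => [X [f fN EX]] [Y [g gN EY]] /=.
by exists (f * g); [exact: gpredM | rewrite EX EY lcosetM].
Qed.

Fact quotV_subproof q : exists2 g, g \in normaliser H & invset q = lcoset g H.
Proof.
case: q => [X [g gN EX]] /=.
by exists g^-1; [exact: gpredVr | rewrite EX lcosetV].
Qed.

Definition quot1 : quot H := coset (normaliser1 H).
Definition quotM q q' : quot H := MkQuot (quotM_subproof q q').
Definition quotV q : quot H := MkQuot (quotV_subproof q).

Lemma quotMA : associative quotM.
Proof.
case=> [X [f fN EX]] [Y [g gN EY]] [Z [h hN EZ]]; apply: quot_inj => /=.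
by rewrite EX EY EZ !lcosetM ?gpredM // mulgA.
Qed.

Lemma quot1M : left_id quot1 quotM.
Proof.
by case=> [X [f fN EX]]; apply: quot_inj => /=; rewrite EX lcosetM // mul1g.
Qed.

Lemma quotM1 : right_id quot1 quotM.
Proof.
case=> [X [f fN EX]]; apply: quot_inj => /=.
by rewrite EX lcosetM ?gpred1 // mulg1.
Qed.

Lemma quotVM : left_inverse quot1 quotV quotM.
Proof.
case=> [X [f fN EX]]; apply: quot_inj => /=.
by rewrite EX lcosetV // lcosetM // mulVg.
Qed.

Lemma quotMV : right_inverse quot1 quotV quotM.
Proof.
case=> [X [f fN EX]]; apply: quot_inj => /=.
by rewrite EX lcosetV // lcosetM ?gpredVr // mulgV.
Qed.

HB.instance Definition _ :=
  isGroup.Build (quot H) quotMA quot1M quotM1 quotVM quotMV.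

End Quot.
End Normaliser.

Section Holomorph.
Variable G : groupType.
Implicit Types (s x : G) (f : Perm G).

Fact rho_bij s : bijective (fun x => x * s^-1).
Proof. by exists (fun x => x * s) => x; rewrite ?mulgVK ?mulgK. Qed.

Definition rho s : Perm G := MkPerm (rho_bij s).

Definition Aut : {pred Perm G} :=
  [pred f : Perm G | `[< {morph f : x y / x * y} >] ].

Lemma AutP f : reflect {morph f : x y / x * y} (f \in Aut).
Proof. exact: asboolP. Qed.

Fact Aut1 : 1 \in Aut.
Proof. exact/AutP. Qed.

Fact AutM : mulg_closed Aut.
Proof. by move=> f g /AutP fA /AutP gA; apply/AutP => x y; rewrite !permME gA fA. Qed.

Fact AutV : invg_closed Aut.
Proof.
move=> f /AutP fA; apply/AutP => x y; apply: (can_inj (permKV f)).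
by rewrite fA !permVK.
Qed.

HB.instance Definition _ := isMulClosed.Build (Perm G) Aut AutM.
HB.instance Definition _ := isMul1Closed.Build (Perm G) Aut Aut1.
HB.instance Definition _ := isInvClosed.Build (Perm G) Aut AutV.

Definition Hol : {pred Perm G} :=
  [pred f | `[< exists s, exists2 a, a \in Aut & f = rho s * a >] ].

Lemma HolP f :
  reflect (exists s, exists2 a, a \in Aut & f = rho s * a) (f \in Hol).
Proof. exact: asboolP. Qed.

Lemma rhoM : {morph rho : s t / s * t}.
Proof. by move=> s t; apply: permP => x; rewrite permME /= invgM mulgA. Qed.

Lemma Aut_rho a s : a \in Aut -> a * rho s = rho (a s) * a.
Proof.
move=> /AutP aM; apply: permP => x; rewrite !permME /= aM; congr (_ * _).
apply/esym/mulg1_eq; rewrite -aM mulgV.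
by apply: (mulgI (a 1)); rewrite -aM !mulg1.
Qed.

Fact Hol1 : 1 \in Hol.
Proof.
apply/HolP; exists 1, 1; first exact: Aut1.
by apply: permP => x; rewrite permME /= invg1 mulg1.
Qed.

Fact HolM : mulg_closed Hol.
Proof.
move=> _ _ /HolP[s [a aA ->]] /HolP[t [b bA ->]]; apply/HolP.
exists (s * a t), (a * b); first exact: AutM.
by rewrite rhoM -!mulgA [a * (rho t * b)]mulgA Aut_rho // !mulgA.
Qed.

Fact HolV : invg_closed Hol.
Proof.
move=> _ /HolP[s [a aA ->]]; apply/HolP; exists (a^-1 s^-1), a^-1.
  exact: AutV.
rewrite -Aut_rho ?AutV // invgM; congr (_ * _); apply: mulg1_eq.
by apply: permP => x; rewrite permME /= invgK mulgK.
Qed.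

HB.instance Definition _ := isMulClosed.Build (Perm G) Hol HolM.
HB.instance Definition _ := isMul1Closed.Build (Perm G) Hol Hol1.
HB.instance Definition _ := isInvClosed.Build (Perm G) Hol HolV.

Definition NHol : {pred Perm G} := normaliser Hol.

(* T(G) = NHol(G) / Hol(G) *)
Definition Tgrp : groupType := quot Hol.

End Holomorph.

Arguments Aut G _ : clear implicits.
Arguments Hol G _ : clear implicits.
Arguments NHol G _ : clear implicits.

(* S(x, i) = 1 + x + ... + x^(i-1) *)
Definition geomS (x i : nat) : nat := (\sum_(0 <= j < i) x ^ j)%N.

(* epsilon_s is eps (p s). *)
Definition eps (p : nat) : nat := if (p == 2)%N then 1%N else 0%N.

(* Main.v *)
Require Import Defs.
From mathcomp Require Import all_boot all_order all_algebra.
From mathcomp Require Import boolp classical_sets zify ring.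

(* Write [tau^i] for [\prod_s tau_s ^+ i_s], and let [l_s] be the exponent of
   [tau_s] modulo [p_s ^ n_s], a homomorphism on [G].  Since
   [S(1 + q, i + j) = S(1 + q, i) + S(1 + q, j) + q S(1 + q, i) S(1 + q, j)] and
   [S(k_s, i)] is congruent to [i] modulo [p_s ^ m_s], the map [pi] satisfies
   [pi (g h) = pi g * pi h * B (pi g) (pi h)], where
   [B g h = \prod_s tau_s ^+ (u_s p_s^m_s l_s(g) l_s(h))] (called [twist] below)
   is central and bimultiplicative.  Hence [pi * rho x * pi^-1] is a right translation times the
   automorphism [y |-> y * B y c].  An automorphism of [G] fixes every
   [tau_s ^+ p_s^m_s] and preserves [l_s] modulo [p_s ^ (n_s - m_s)], so it
   preserves [B], and its conjugate by [pi^-1] is again an automorphism.  As [pi]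
   has finite order, these two inclusions suffice for [pi] to normalise [Hol G].
   Powers of [pi] fix [A] and every [tau_s], so they lie in [Hol G] only when
   trivial; under (4) the [x]-th power of [pi] sends [i] to
   [i + x 'C(i, 2) u_s p_s^m_s] in each exponent, which gives the order. *)

Set Implicit Arguments.
Unset Strict Implicit.
Unset Printing Implicit Defensive.

Local Open Scope group_scope.

(** * Arithmetic of [geomS] and of binomial coefficients modulo prime powers *)

Lemma geomS0 x : geomS x 0 = 0%N.
Proof. by rewrite /geomS big_geq. Qed.

Lemma geomS_recr x i : geomS x i.+1 = (geomS x i + x ^ i)%N.
Proof. by rewrite /geomS big_nat_recr. Qed.

Lemma expn_geomS q i : ((1 + q) ^ i = 1 + q * geomS (1 + q) i)%N.
Proof.
elim: i => [|i IH]; first by rewrite geomS0 muln0.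
rewrite geomS_recr mulnDr addnA -IH expnS; ring.
Qed.

Lemma geomSD q i j :
  geomS (1 + q) (i + j) = (geomS (1 + q) i + geomS (1 + q) j
                           + q * geomS (1 + q) i * geomS (1 + q) j)%N.
Proof.
elim: i => [|i IH]; first by rewrite geomS0 muln0 addn0.
rewrite addSn !geomS_recr IH expnD !expn_geomS; ring.
Qed.

(** This is the binomial expansion of [((1 + q) ^ i - 1) / q], whose terms beyond the first two are
    divisible by [q * q]. *)
Lemma geomS_bin q i :
  exists w, geomS (1 + q) i = (i + 'C(i, 2) * q + q * q * w)%N.
Proof.
elim: i => [|i [w IH]]; first by exists 0%N; rewrite geomS0 muln0.
exists (w + 'C(i, 2) + q * w)%N.
rewrite geomS_recr expn_geomS IH binS bin1; ring.
Qed.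

(** The truncated subtraction is exact since [geomS] is at least [i]. The explicit multiple of [P]
    is the form to which [tprod_central] applies. *)
Lemma geomS_mod u P i :
  geomS (1 + u * P) i = (i + P * ((geomS (1 + u * P) i - i) %/ P))%N.
Proof.
have [w ->] := geomS_bin (u * P) i.
rewrite -addnA addKn [(P * _)%N]mulnC divnK //.
by apply: dvdn_add; [rewrite mulnA dvdn_mull | rewrite -mulnA mulnAC dvdn_mull].
Qed.

Lemma eq_modM d x x' y y' :
  x = x' %[mod d] -> y = y' %[mod d] -> x * y = x' * y' %[mod d].
Proof. by move=> Ex Ey; rewrite -modnMm Ex Ey modnMm. Qed.

Lemma eq_mod_mul_exp p m n x y : (m <= n)%N ->
  x = y %[mod p ^ (n - m)] -> p ^ m * x = p ^ m * y %[mod p ^ n].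
Proof. by move=> le_mn E; rewrite -(subnKC le_mn) expnD -!muln_modr E. Qed.

Lemma bin2D x y : 'C(x + y, 2) = ('C(x, 2) + 'C(y, 2) + x * y)%N.
Proof.
elim: x => [|x IH]; first by rewrite mul0n !addn0.
by rewrite addSn !binS !bin1 IH; ring.
Qed.

(** Adding [t * p ^ m] to [x] changes ['C(x, 2)] by ['C(t * p ^ m, 2)] plus a cross term divisible
    by [p ^ m]. After multiplication by [p ^ m] both vanish modulo [p ^ n]. When [p = 2] the halving
    in the binomial costs one factor 2, which [eps] accounts for. *)
Lemma eq_mod_bin2 p m n x y : prime p -> (0 < m)%N -> (n <= 2 * m - eps p)%N ->
  x = y %[mod p ^ m] ->
  'C(x, 2) * p ^ m = 'C(y, 2) * p ^ m %[mod p ^ n].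
Proof.
move=> pp m0 le_n.
have key t : (p ^ n %| 'C(t * p ^ m, 2) * p ^ m)%N.
  have [p2|p2] := eqVneq p 2%N.
    move: le_n; rewrite /eps p2 /= => le_n; case: m m0 le_n => // m _ le_n.
    have -> : (t * 2 ^ m.+1 = (t * 2 ^ m).*2)%N by rewrite expnS -muln2; ring.
    rewrite bin2 -doubleMl doubleK mulnAC mulnC -!mulnA.
    do 2 apply: dvdn_mull; rewrite -expnD dvdn_exp2l //; lia.
  apply: (@dvdn_trans (p ^ m * p ^ m)).
    by rewrite -expnD dvdn_exp2l //; move: le_n; rewrite /eps (negPf p2) /=; lia.
  (* For odd [p], 2 is coprime to [p ^ m], and [2 * 'C(z, 2) = (z - 1) * z]. *)
  rewrite dvdn_pmul2r ?expn_gt0 ?prime_gt0 // -(@Gauss_dvdr _ 2).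
    by rewrite mul_bin_left bin1 !dvdn_mull.
  by rewrite coprimeXl // prime_coprime // dvdn_prime2.
suff red z : 'C(z, 2) * p ^ m = 'C(z %% p ^ m, 2) * p ^ m %[mod p ^ n].
  by move=> E; rewrite red E -red.
rewrite {1}(divn_eq z (p ^ m)) addnC bin2D.
have [w ->] : exists w, (('C(z %% p ^ m, 2) + 'C(z %/ p ^ m * p ^ m, 2) +
    z %% p ^ m * (z %/ p ^ m * p ^ m)) * p ^ m =
    'C(z %% p ^ m, 2) * p ^ m + w * p ^ n)%N.
  have /dvdnP[a aE] := key (z %/ p ^ m)%N.
  have /dvdnP[b bE] : (p ^ n %| p ^ m * p ^ m)%N.
    by rewrite -expnD dvdn_exp2l //; lia.
  exists (a + (z %% p ^ m) * (z %/ p ^ m) * b)%N.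
  rewrite !mulnDl aE -!mulnA bE; ring.
by rewrite addnC modnMDl.
Qed.

(** With [q = u * p ^ m], [q * q] vanishes modulo [p ^ n], so each iteration adds ['C(x, 2) * q].
    The iterates agree modulo [p ^ m], so by [eq_mod_bin2] this increment is the same every time. *)
Lemma iter_geomS p m n u k i :
  prime p -> (0 < m)%N -> (m <= n)%N -> (n <= 2 * m - eps p)%N ->
  iter k (geomS (1 + u * p ^ m)) i = i + k * 'C(i, 2) * (u * p ^ m) %[mod p ^ n].
Proof.
move=> pp m0 le_mn le_n; elim: k => [|k IH] /=; first by rewrite mul0n addn0.
set x := iter k _ i in IH *.
have [w ->] := geomS_bin (u * p ^ m) x.
have /dvdnP[b bE] : (p ^ n %| p ^ m * p ^ m)%N.
  by rewrite -expnD dvdn_exp2l //; lia.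
have -> : (u * p ^ m * (u * p ^ m) * w = u * u * w * b * p ^ n)%N.
  by rewrite -[RHS]mulnA -bE; ring.
rewrite addnC modnMDl.
have xi : x = i %[mod p ^ m].
  rewrite -(modn_dvdm x (dvdn_exp2l p le_mn)) IH modn_dvdm ?dvdn_exp2l //.
  by rewrite mulnA addnC modnMDl.
have := eq_mod_bin2 pp m0 le_n xi => C.
rewrite mulnCA -modnDm -modnMmr C modnMmr modnDm -modnDml IH modnDml.
by congr (_ %% _); ring.
Qed.

(** * Generalities on orders, normalisers, cosets and holomorphs *)

Lemma expg_mod_order (G : groupType) (x : G) d i j :
  has_order x d -> (x ^+ i = x ^+ j <-> i = j %[mod d])%N.
Proof.
case=> d0 xd xmin.
have xmod k : x ^+ k = x ^+ (k %% d)%N.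
  by rewrite {1}(divn_eq k d) mulnC expgnDr expgnA xd expg1n mul1g.
split=> [|E]; last by rewrite xmod E -xmod.
wlog le_ij : i j / (i <= j)%N.
  by move=> W; case: (leqP i j) => [/W //|/ltnW/W {}W /esym/W].
move=> E; apply/eqP; rewrite eq_sym eqn_mod_dvd //.
have xji : x ^+ (j - i)%N = 1 by rewrite expgnFr // E mulgV.
have : x ^+ ((j - i) %% d)%N = 1 by rewrite -xmod.
rewrite /dvdn; case: posnP => [-> //|/xmin] H /H.
by rewrite leqNgt ltn_mod d0.
Qed.

Lemma expg_coprime_eq1 (G : groupType) (x : G) i j :
  (0 < i)%N -> coprime i j -> x ^+ i = 1 -> x ^+ j = 1 -> x = 1.
Proof.
move=> i0 /eqP co xi xj; case: (egcdnP j i0) => a b; rewrite co => E _.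
have : x ^+ (b * j + 1)%N = 1 by rewrite -E mulnC expgnA xi expg1n.
by rewrite expgnDr mulnC expgnA xj expg1n mul1g.
Qed.

(** The inverse of [g] is its power [g ^+ N.-1], so the reverse inclusion is the given one
    iterated. *)
Lemma normaliser_finite_order (K : groupType) (H : groupClosed K) (g : K) N :
  (0 < N)%N -> g ^+ N = 1 -> (forall x, x \in H -> g * x * g^-1 \in H) ->
  g \in normaliser H.
Proof.
move=> N0 gN gH; apply/normaliserP => x; apply/idP/idP; last exact: gH.
have gXH i y : y \in H -> g ^+ i * y * (g ^+ i)^-1 \in H.
  elim: i => [|i IH] yH; first by rewrite expg0 invg1 mulg1 mul1g.
  by move: (gH _ (IH yH)); rewrite expgS invgM !mulgA.
move/(gXH N.-1); rewrite !mulgA -expgSr prednK // gN mul1g.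
by rewrite -mulgA -invgM -expgSr prednK // gN invg1 mulg1.
Qed.

Lemma pigeonhole (T : finType) (f : nat -> T) :
  exists i, exists2 j, (i < j)%N & f i = f j.
Proof.
have /injectivePn[x [y xy E]] : ~~ injectiveb (fun x : 'I_#|T|.+1 => f x).
  by apply/negP => /injectiveP/leq_card; rewrite card_ord ltnn.
by move: xy; rewrite neq_ltn => /orP[]; [exists x, y | exists y, x].
Qed.

Lemma coset_expg (K : groupType) (H : groupClosed K) (g : K)
    (gN : g \in normaliser H) i :
  qset (coset gN ^+ i) = lcoset (g ^+ i) H.
Proof.
elim: i => [//|i IH]; rewrite !expgSr /=.
by rewrite IH lcosetM.
Qed.

Lemma coset_expg_eq1 (K : groupType) (H : groupClosed K) (g : K)
    (gN : g \in normaliser H) i :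
  coset gN ^+ i = 1 -> g ^+ i \in H.
Proof.
move=> /(congr1 (@qset _ _)); rewrite coset_expg => E.
have : lcoset (g ^+ i) H (g ^+ i) by exists 1; rewrite ?mulg1 //= gpred1.
by rewrite E => -[x xH <-]; rewrite mul1g.
Qed.

Lemma Aut_id (G : groupType) (f : Perm G) : f \in Aut G -> f 1 = 1.
Proof.
by move/AutP=> fM; apply: (mulgI (f 1)); rewrite -fM !mulg1.
Qed.

Lemma Aut_expg (G : groupType) (f : Perm G) x k :
  f \in Aut G -> f (x ^+ k) = f x ^+ k.
Proof.
move=> fA; elim: k => [|k IH]; first exact: Aut_id.
by rewrite !expgS (AutP _ fA) IH.
Qed.

(** Since [rho s * a] sends 1 to [s^-1], fixing 1 forces [s = 1]. *)
Lemma Hol_fix1 (G : groupType) (f : Perm G) : f \in Hol G -> f 1 = 1 -> f \in Aut G.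
Proof.
move=> /HolP[s [a aA ->]]; rewrite permME.
rewrite (Aut_id aA) /= mul1g => /eqP; rewrite invg_eq1 => /eqP ->.
suff -> : rho 1 = 1 :> Perm G by rewrite mul1g.
by apply: Defs.permP => x; rewrite /= invg1 mulg1.
Qed.

Lemma dvdn_prod_coprime r (e : 'I_r -> nat) k :
  (forall s t, s != t -> coprime (e s) (e t)) -> (forall s, e s %| k)%N ->
  (\prod_(s < r) e s %| k)%N.
Proof.
move=> co dv; have := index_enum_uniq 'I_r.
elim: (index_enum _) => [|s q IH] /=; first by rewrite big_nil dvd1n.
case/andP=> sq /IH {}IH; rewrite big_cons Gauss_dvd ?dv //.
elim: q sq {IH} => [|t q IH] /=; first by rewrite big_nil coprimen1.
by rewrite inE negb_or big_cons coprimeMr => /andP[/co -> /IH].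
Qed.

(** * Exponents of the [tau s] as homomorphisms modulo [p s ^ n s] *)

Section Twist.

Variables (G : groupType) (A : groupClosed G) (r : nat) (p n m u : 'I_r -> nat).
Variables (tau : 'I_r -> G) (l : G -> 'I_r -> nat).
Implicit Types (i j : 'I_r -> nat) (s t : 'I_r) (a g h : G).

Definition tprod i : G := \prod_(s < r) tau s ^+ i s.

Hypothesis tauC : forall s t, commute (tau s) (tau t).
Hypothesis tau_order : forall s, has_order (tau s) (p s ^ n s)%N.
Hypothesis A_normal : {in A, forall a g, a ^ g \in A}.
Hypothesis tprod_modA : forall i j, tprod i / tprod j \in A -> tprod i = tprod j.
Hypothesis tprod_inj : forall i j, tprod i = tprod j ->
  forall s, tau s ^+ i s = tau s ^+ j s.
Hypothesis lP : forall g, exists2 a, a \in A & g = a * tprod (l g).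

Lemma tprodD i j : tprod (fun s => i s + j s)%N = tprod i * tprod j.
Proof.
rewrite /tprod -prodgM_commute.
  by apply: eq_bigr => s _; rewrite expgnDr.
by move=> s t *; apply: commuteX2; apply: tauC.
Qed.

Lemma eq_tprod i j : (forall s, i s = j s %[mod p s ^ n s]) -> tprod i = tprod j.
Proof. by move=> E; apply: eq_bigr => s _; apply/expg_mod_order. Qed.

Lemma tprod_eq i j : tprod i = tprod j -> forall s, i s = j s %[mod p s ^ n s].
Proof. by move=> /tprod_inj E s; apply/(expg_mod_order _ _ (tau_order s)). Qed.

Lemma tprod_single s k : tprod (fun t => (s == t) * k)%N = tau s ^+ k.
Proof.
have -> : tau s ^+ k = \prod_(t < r | t == s) tau t ^+ k by rewrite big_pred1_eq.
rewrite big_mkcond.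
by apply: eq_bigr => t _; rewrite eq_sym; case: eqP; rewrite ?mul1n.
Qed.

(** The function [l] merely chooses exponents; [tprod_modA] and [tprod_inj] make their residues
    unique. *)
Lemma expo_decomp a i s : a \in A -> l (a * tprod i) s = i s %[mod p s ^ n s].
Proof.
move=> aA; have [b bA E] := lP (a * tprod i).
move: s; apply/tprod_eq/tprod_modA.
have -> : tprod (l (a * tprod i)) / tprod i = b^-1 * a.
  by apply/eqP; rewrite divg_eq -mulgA [X in _ == _ * X]E mulKg.
by rewrite gpredM // gpredV.
Qed.

Lemma expo_A a s : a \in A -> l a s = 0 %[mod p s ^ n s].
Proof.
move=> aA; rewrite -[RHS](expo_decomp (fun=> 0%N) s aA).
by rewrite /tprod big1 ?mulg1.
Qed.

Lemma mem_A g : (forall s, l g s = 0 %[mod p s ^ n s]) -> g \in A.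
Proof.
move=> /eq_tprod E; have [a aA ->] := lP g.
by rewrite E /tprod big1 ?mulg1.
Qed.

Lemma expo_tau s t : l (tau s) t = (s == t) %[mod p t ^ n t].
Proof.
rewrite -[tau s]expg1 -tprod_single -[tprod _]mul1g.
by rewrite expo_decomp ?gpred1 // muln1.
Qed.

Lemma mulg_decomp a b i j : b \in A ->
  a * tprod i * (b * tprod j)
  = a * b ^ (tprod i)^-1 * tprod (fun s => i s + j s)%N.
Proof. by move=> bA; rewrite tprodD conjgE invgK !mulgA mulgVK. Qed.

Lemma expoM g h s : l (g * h) s = l g s + l h s %[mod p s ^ n s].
Proof.
have [a aA gE] := lP g; have [b bA hE] := lP h.
rewrite {1}gE {1}hE mulg_decomp // expo_decomp // gpredM //.
exact: A_normal.
Qed.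

Lemma expoX g k s : l (g ^+ k) s = k * l g s %[mod p s ^ n s].
Proof.
elim: k => [|k IH]; first by rewrite expo_A ?gpred1.
by rewrite expgS expoM -modnDmr IH modnDmr mulSn.
Qed.

Lemma decomp_ind (P : G -> Prop) :
  (forall g h, P g -> P h -> P (g * h)) -> (forall a, a \in A -> P a) ->
  (forall s, P (tau s)) -> forall g, P g.
Proof.
move=> PM PA Ptau g; have [a aA ->] := lP g; apply: (PM); first exact: PA.
have P1 : P 1 by apply: PA; exact: gpred1.
apply: (big_ind P) => // s _.
by elim: (l g s) => // k IH; rewrite expgS; apply: PM.
Qed.

(** * The central pairing [twist] and the failure of [pi] to be multiplicative *)

Hypothesis p_prime : forall s, prime (p s).
Hypothesis p_inj : injective p.
Hypothesis m_le_n : forall s, (m s <= n s)%N.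
Hypothesis A_cent : forall s a, a \in A -> commute a (tau s ^+ (p s ^ m s)%N).

Lemma tprod_central i g : commute g (tprod (fun s => p s ^ m s * i s)%N).
Proof.
have [a aA ->] := lP g; apply/commute_sym/commuteM; apply/commute_sym.
  by apply: commute_prod => s _; rewrite expgnA; apply/commuteX/A_cent.
rewrite /commute -!tprodD; congr tprod; apply/funext => s; exact: addnC.
Qed.

Definition twist g h : G := tprod (fun s => u s * p s ^ m s * (l g s * l h s))%N.

Lemma twistE g h :
  twist g h = tprod (fun s => p s ^ m s * (u s * (l g s * l h s)))%N.
Proof. by congr tprod; apply/funext => s; rewrite mulnAC mulnC. Qed.

Lemma twist_central g h x : commute x (twist g h).
Proof.
rewrite twistE; exact: tprod_central.
Qed.

Lemma twistM g g' h : twist (g * g') h = twist g h * twist g' h.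
Proof.
rewrite -tprodD; apply: eq_tprod => s.
by rewrite -mulnDr -mulnDl; do 2 apply: eq_modM => //; exact: expoM.
Qed.

Variable pi : Perm G.
Hypothesis pi_def : forall a i, a \in A ->
  pi (a * tprod i) = a * tprod (fun s => geomS (1 + u s * p s ^ m s) (i s)).

Lemma piM_twist g h : pi (g * h) = pi g * pi h * twist (pi g) (pi h).
Proof.
have [a aA ->] := lP g; have [b bA ->] := lP h.
set i := l g; set j := l h.
have abA : a * b ^ (tprod i)^-1 \in A by apply: gpredM => //; exact: A_normal.
rewrite mulg_decomp // !pi_def //.
pose S s := geomS (1 + u s * p s ^ m s); rewrite /twist.
have -> : tprod (fun s => S s (i s + j s)%N) = tprod (fun s => S s (i s)) *
    tprod (fun s => S s (j s)) *
    tprod (fun s => u s * p s ^ m s * (S s (i s) * S s (j s)))%N.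
  by rewrite -!tprodD; congr tprod; apply/funext => s; rewrite /S geomSD mulnA.
rewrite [in RHS]mulg_decomp // tprodD.
(* [pi] shifts the exponent of [tau s] by a multiple of [p s ^ m s], that is, by a central factor,
   so the action on [A] is unchanged. *)
have -> : b ^ (tprod (fun s => S s (i s)))^-1 = b ^ (tprod i)^-1.
  have -> : tprod (fun s => S s (i s)) =
      tprod i * tprod (fun s => p s ^ m s * ((S s (i s) - i s) %/ p s ^ m s))%N.
    by rewrite -tprodD; congr tprod; apply/funext => s; exact: geomS_mod.
  rewrite invgM conjgM; congr (_ ^ _); apply/conjg_fixP/commgP/commuteV.
  exact: tprod_central.
rewrite !mulgA; congr (_ * _); apply: eq_tprod => s.
by do 2 apply: eq_modM => //; rewrite expo_decomp.
Qed.

Lemma pi_conj_rho x : pi * rho x * pi^-1 \in Hol G.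
Proof.
(* By [piM_twist], the conjugate sends [y] to [y * c * twist y c]; composing with [rho c] strips the
   translation by [c]. *)
pose c := pi x^-1; pose f := rho c * (pi * rho x * pi^-1).
have fE y : f y = y * twist y c.
  rewrite /f !permME /= piM_twist permVK -/c -[_ * c * _]mulgA.
  by rewrite (twist_central y c c) mulgA mulgK.
apply/HolP; exists c^-1, f.
  by apply/AutP => y z; rewrite !fE twistM !mulgA; congr (_ * _);
     rewrite -!mulgA (twist_central y c z).
rewrite /f mulgA -rhoM mulVg.
by apply: Defs.permP => y; rewrite permME /= invg1 mulg1.
Qed.

(** * Automorphisms of [G] and their conjugates by [pi^-1] *)

Variable e : nat.
Hypothesis A_exp : forall a, a \in A -> a ^+ e = 1.
Hypothesis e_coprime : forall s, coprime e (p s).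
Hypothesis Aut_tau : forall theta s c z, theta \in Aut G -> c \in A ->
  theta (tau s) = c * tau s ^+ z -> z = 1 %[mod p s ^ (n s - m s)].

Section Automorphism.

Variable theta : Perm G.
Hypothesis thetaA : theta \in Aut G.

(** The [e]-th power of [theta a] is 1, so [e] times each of its exponents is zero, and [e] is
    invertible modulo [p s ^ n s]. *)
Lemma Aut_mem_A a : a \in A -> theta a \in A.
Proof.
move=> aA; apply: mem_A => s; apply/eqP; rewrite mod0n.
rewrite -/(dvdn _ _) -(@Gauss_dvdr _ e) ?coprimeXl 1?coprime_sym //.
by rewrite /dvdn -expoX -Aut_expg // A_exp // Aut_id // expo_A ?gpred1 ?mod0n.
Qed.

(** Here [theta (tau s)] is killed by [p s ^ n s], which is invertible modulo [p t ^ n t]. *)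
Lemma expo_Aut_tau_neq s t : s != t -> l (theta (tau s)) t = 0 %[mod p t ^ n t].
Proof.
move=> st; apply/eqP; rewrite mod0n.
rewrite -/(dvdn _ _) -(@Gauss_dvdr _ (p s ^ n s)); last first.
  rewrite coprimeXl // coprimeXr // prime_coprime // dvdn_prime2 //.
  by rewrite (inj_eq p_inj) eq_sym.
rewrite /dvdn -expoX -Aut_expg //; have [_ -> _] := tau_order s.
by rewrite Aut_id // expo_A ?gpred1 ?mod0n.
Qed.

Lemma expo_Aut_tau s : l (theta (tau s)) s = 1 %[mod p s ^ (n s - m s)].
Proof.
have [c cA E] := lP (theta (tau s)); apply: (Aut_tau thetaA cA).
rewrite {1}E -tprod_single; congr (_ * _); apply: eq_tprod => t.
by case: (eqVneq s t) => [<-|st]; rewrite ?mul1n // mul0n expo_Aut_tau_neq.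
Qed.

Lemma expo_Aut g s : l (theta g) s = l g s %[mod p s ^ (n s - m s)].
Proof.
have sub x y : x = y %[mod p s ^ n s] -> x = y %[mod p s ^ (n s - m s)].
  have dv : (p s ^ (n s - m s) %| p s ^ n s)%N by rewrite dvdn_exp2l // leq_subr.
  by move=> E; rewrite -(modn_dvdm x dv) E modn_dvdm.
elim/decomp_ind: g => [g h IHg IHh|a aA|t].
- rewrite (AutP _ thetaA) (sub _ _ (expoM _ _ _)) -modnDm IHg IHh modnDm.
  by apply/esym/sub/expoM.
- by apply: sub; rewrite !expo_A ?Aut_mem_A.
case: (eqVneq t s) => [->|ts].
  by rewrite expo_Aut_tau (sub _ _ (expo_tau _ _)) eqxx.
by rewrite (sub _ _ (expo_tau _ _)) (negPf ts); apply/sub/expo_Aut_tau_neq.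
Qed.

(* The [A]-part of [theta z] commutes with [z] and so is a [p s]-element of a
   group of exponent prime to [p s]. *)
Lemma Aut_fix_tau s : theta (tau s ^+ (p s ^ m s)%N) = tau s ^+ (p s ^ m s)%N.
Proof.
set z := tau s ^+ _; have [c cA E] := lP (theta z).
have {}E : theta z = c * z.
  rewrite {1}E /z -[in RHS](tprod_single s); congr (_ * _); apply: eq_tprod => t.
  rewrite Aut_expg // expoX; case: (eqVneq s t) => [<-|st].
    rewrite mul1n -[in RHS](muln1 (_ ^ _)%N); apply: eq_mod_mul_exp => //.
    exact: expo_Aut_tau.
  by rewrite -modnMmr expo_Aut_tau_neq // modnMmr muln0 mul0n.
have zn : z ^+ (p s ^ n s)%N = 1.
  by have [_ tn _] := tau_order s; rewrite /z expgnAC tn expg1n.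
have cn : c ^+ (p s ^ n s)%N = 1.
  rewrite -[LHS]mulg1 -zn -expgMn; last exact: A_cent.
  by rewrite -E -Aut_expg // zn Aut_id.
suff c1 : c = 1 by rewrite E c1 mul1g.
apply: (expg_coprime_eq1 _ _ cn (A_exp cA)).
  by rewrite expn_gt0 prime_gt0.
by rewrite coprimeXl // coprime_sym.
Qed.

Lemma Aut_fix_tprod i :
  theta (tprod (fun s => p s ^ m s * i s)%N) = tprod (fun s => p s ^ m s * i s)%N.
Proof.
rewrite /tprod (big_morph theta (AutP _ thetaA) (Aut_id thetaA)).
by apply: eq_bigr => s _; rewrite expgnA Aut_expg // Aut_fix_tau.
Qed.

(** The left side is a product of powers of the fixed elements [tau s ^+ (p s ^ m s)]. On the right,
    exponents change only modulo [p s ^ (n s - m s)], which the factor [p s ^ m s] absorbs. *)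
Lemma Aut_twist g h : theta (twist g h) = twist (theta g) (theta h).
Proof.
rewrite !twistE Aut_fix_tprod; apply: eq_tprod => s.
apply: eq_mod_mul_exp => //.
by do 2 apply: eq_modM => //; rewrite expo_Aut.
Qed.

Lemma pi_conj_Aut : pi^-1 * theta * pi \in Aut G.
Proof.
apply/AutP => g h; apply: (can_inj (permKV pi)).
rewrite [RHS]piM_twist !permME !permVK piM_twist !(AutP _ thetaA).
by rewrite Aut_twist.
Qed.

End Automorphism.

(** * Finite order of [pi] and its membership in [NHol G] *)

Lemma pi_expg a i k : a \in A ->
  (pi ^+ k) (a * tprod i) =
  a * tprod (fun s => iter k (geomS (1 + u s * p s ^ m s)) (i s)).
Proof. by move=> aA; elim: k => [//|k IH]; rewrite expgS permME IH pi_def. Qed.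

(** [G] may be infinite, but [pi] moves only exponents, hence acts through the finite set of residue
    vectors modulo the common modulus [M]; two of its powers therefore coincide. *)
Lemma pi_finite_order : exists2 N, (0 < N)%N & pi ^+ N = 1.
Proof.
pose M := (\prod_(s < r) p s ^ n s)%N.
have M0 : (0 < M)%N by rewrite prodn_gt0 // => s; rewrite expn_gt0 prime_gt0.
pose mo x : 'I_M := Ordinal (ltn_pmod x M0).
pose f k :=
  [ffun i : {ffun 'I_r -> 'I_M} =>
    [ffun s => mo (iter k (geomS (1 + u s * p s ^ m s)) (i s))]].
have [k [k' lt_k /ffunP E]] := pigeonhole f.
have pn_M s : (p s ^ n s %| M)%N by rewrite /M (bigD1 s) //= dvdn_mulr.
have {}E : pi ^+ k = pi ^+ k'.
  apply: Defs.permP => g; have [a aA ->] := lP g.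
  pose i := [ffun s => mo (l g s)].
  have -> : tprod (l g) = tprod (fun s => i s).
    by apply: eq_tprod => s; rewrite ffunE /= modn_dvdm.
  rewrite !pi_expg //; congr (_ * _); apply: eq_tprod => s.
  have /ffunP/(_ s)/(congr1 val) := E i; rewrite !ffunE /= => Es.
  by rewrite -[LHS](modn_dvdm _ (pn_M s)) Es modn_dvdm.
exists (k' - k)%N; first by rewrite subn_gt0.
by rewrite expgnFr 1?ltnW // E mulgV.
Qed.

Lemma pi_NHol : pi \in NHol G.
Proof.
have [N N0 piN] := pi_finite_order.
(* [pi_conj_Aut] conjugates by [pi^-1], whereas the claim needs conjugation by [pi]; finite order
   bridges the two. *)
have piA : pi^-1 \in normaliser (Aut G).
  apply: (normaliser_finite_order N0); first by rewrite expVgn piN invg1.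
  by move=> theta thetaA; rewrite invgK; apply: pi_conj_Aut.
apply: (normaliser_finite_order N0 piN) => _ /HolP[x [theta thetaA ->]].
have -> : pi * (rho x * theta) * pi^-1 =
    pi * rho x * pi^-1 * (pi * theta * pi^-1) by rewrite !mulgA mulgVK.
apply: gpredM; first exact: pi_conj_rho.
apply/HolP; exists 1, (pi * theta * pi^-1).
  by move: piA; rewrite gpredV => /normaliserP ->.
by apply: Defs.permP => y; rewrite [RHS]permME /= invg1 mulg1.
Qed.

(** * The order of the coset of [pi] under condition (4) *)

Hypothesis m_pos : forall s, (0 < m s)%N.
Hypothesis p_ndvd_u : forall s, ~~ (p s %| u s)%N.
Hypothesis n_le : forall s, (n s <= 2 * m s - eps (p s))%N.

Lemma pi_expg_binomial a i k : a \in A ->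
  (pi ^+ k) (a * tprod i) =
  a * tprod (fun s => i s + k * 'C(i s, 2) * (u s * p s ^ m s))%N.
Proof.
move=> aA; rewrite pi_expg //; congr (_ * _); apply: eq_tprod => s.
exact: iter_geomS.
Qed.

Lemma pi_expg_order : pi ^+ (\prod_(s < r) p s ^ (n s - m s))%N = 1.
Proof.
apply: Defs.permP => g; have [a aA ->] := lP g.
rewrite pi_expg_binomial //; congr (_ * _); apply: eq_tprod => s.
rewrite (bigD1 s) //= -[in RHS](addn0 (l g s)); apply/eqP.
rewrite eqn_modDl mod0n -/(dvdn _ _) -{1}(subnK (m_le_n s)) expnD.
by apply: dvdn_mul; [rewrite -mulnA dvdn_mulr | rewrite dvdn_mull].
Qed.

Lemma dvdn_pi_order k :
  pi ^+ k \in Hol G -> (\prod_(s < r) p s ^ (n s - m s) %| k)%N.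
Proof.
have tau_pow s x : (pi ^+ k) (tau s ^+ x) =
    tprod (fun t => (s == t) * x + k * 'C((s == t) * x, 2) * (u t * p t ^ m t))%N.
  by rewrite -tprod_single -[tprod _ in LHS]mul1g pi_expg_binomial ?gpred1 // mul1g.
move=> piH; have piA : pi ^+ k \in Aut G.
  apply: Hol_fix1 => //; have := pi_expg_binomial (fun=> 0%N) k (gpred1 : 1 \in A).
  by rewrite /tprod !big1 ?mul1g // => s _; rewrite muln0.
apply: dvdn_prod_coprime => [s t st|s].
  rewrite coprimeXl // coprimeXr // prime_coprime // dvdn_prime2 //.
  by rewrite (inj_eq p_inj).
have tau1 : (pi ^+ k) (tau s) = tau s.
  rewrite -[tau s]expg1 tau_pow -tprod_single; apply: eq_tprod => t.
  by case: eqP; rewrite muln0 addn0.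
(* An automorphism fixing [tau s] fixes its square, but the binomial formula adds
   [k * 'C(2, 2) * (u s * p s ^ m s)] to the exponent 2; this term must vanish modulo
   [p s ^ n s]. *)
have := tau_pow s 2; rewrite Aut_expg // tau1 -tprod_single.
move=> /tprod_eq/(_ s); rewrite eqxx !mul1n muln1 => /eqP.
rewrite -[X in X == _ %[mod _]]addn0 eqn_modDl mod0n eq_sym -/(dvdn _ _).
rewrite -{1}(subnK (m_le_n s)) expnD mulnA dvdn_pmul2r ?expn_gt0 ?prime_gt0 //.
by rewrite Gauss_dvdl // coprimeXl // prime_coprime.
Qed.

End Twist.

(** * From the hypotheses of the theorem to those of the section *)

Lemma cyc_expgn (G : groupType) (x y : G) d :
  has_order x d -> y \in cyc x -> exists i, y = x ^+ i.
Proof.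
move=> [d0 xd _] /asboolP[[i|i] ->]; first by exists i.
(* [Negz i] stands for [-(i + 1)]; a multiple of [d] is added to make it non-negative. *)
exists (d * i.+1 - i.+1)%N.
by rewrite expgnFr ?leq_pmull // expgnA xd expg1n mul1g.
Qed.

Lemma expgn_cyc (G : groupType) (x : G) i : x ^+ i \in cyc x.
Proof. by apply/asboolP; exists (Posz i). Qed.

Lemma mulg_psiX (G : groupType) (A : groupClosed G) (x : G)
    (f : Perm (subgrp A)) :
  (forall a, x * val a * x^-1 = val (f a)) ->
  forall i a, x ^+ i * val a = val ((f ^+ i) a) * x ^+ i.
Proof.
move=> fE; elim=> [|i IH] a; first by rewrite mul1g mulg1.
rewrite !expgS -mulgA IH permME -fE.
by rewrite !mulgA mulgVK.
Qed.

Theorem theorem1p2 (G : groupType) (A C : groupClosed G) (r : nat)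
    (p n u m k : 'I_r -> nat) (tau : 'I_r -> G)
    (psi : 'I_r -> Perm (subgrp A)) (pi : Perm G)
    (p_inj : injective p) (p_prime : forall s, prime (p s))
    (n_pos : forall s, (0 < n s)%N)
    (u_pos : forall s, (0 < u s)%N) (m_pos : forall s, (0 < m s)%N)
    (p_ndvd_u : forall s, ~~ (p s %| u s)%N)
    (m_le_n : forall s, (m s <= n s)%N)
    (m_ge2 : forall s, p s = 2%N -> (2 <= m s)%N)
    (k_def : forall s, k s = (1 + u s * p s ^ m s)%N)
    (* G = A ><| (<tau_1> x ... x <tau_r>) *)
    (G_sdprod : is_sdprod A C)
    (C_dprod : is_dprod C (fun s => cyc (tau s)))
    (tau_order : forall s, has_order (tau s) (p s ^ n s)%N)
    (psi_Aut : forall s, psi s \in Aut (subgrp A))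
    (psi_def : forall s (a : subgrp A),
       tau s * val a * (tau s)^-1 = val (psi s a))
    (pi_def : forall (a : G) (i : 'I_r -> nat), a \in A ->
       pi (a * \prod_(s < r) tau s ^+ i s)
       = a * \prod_(s < r) tau s ^+ geomS (k s) (i s))
    (cond1 : exists e, has_exponent (subgrp A) e /\
       forall s, coprime e (p s))
    (cond2 : forall s, exists o, has_order (psi s) o /\ (o %| p s ^ m s)%N)
    (cond3 : forall (theta : Perm G) (s : 'I_r) (c : G) (z : int),
       theta \in Aut G -> c \in A -> theta (tau s) = c * expgz (tau s) z ->
       (z = 1 %[mod (p s ^ (n s - m s + eps (p s)))%N])%Z) :
  exists piN : pi \in NHol G,
    (forall s, (n s <= 2 * m s - eps (p s))%N) ->
    has_order (coset piN : Tgrp G) (\prod_(s < r) p s ^ (n s - m s))%N.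
Proof.
have {k_def} kE : k = fun s => (1 + u s * p s ^ m s)%N by apply/funext.
subst k.
have [A_normal G_AC AC_disj] := G_sdprod.
have [cycC cyc_in_C C_cyc cyc_inj] := C_dprod.
have tauC s t : commute (tau s) (tau t).
  have [->//|st] := eqVneq s t.
  by apply: (cycC s t) => //; rewrite -[tau _]expg1 expgn_cyc.
have tprodC i : tprod tau i \in C by apply: cyc_in_C => s; exact: expgn_cyc.
have tprod_inj i j : tprod tau i = tprod tau j ->
    forall s, tau s ^+ i s = tau s ^+ j s.
  by apply: (cyc_inj (fun s => tau s ^+ i s) (fun s => tau s ^+ j s)) => s;
     exact: expgn_cyc.
have tprod_modA i j : tprod tau i / tprod tau j \in A ->
    tprod tau i = tprod tau j.
  by move=> ijA; apply/divg1_eq/AC_disj => //; apply: gpredF.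
have /choice[l lP] : forall g, exists i, exists2 a, a \in A & g = a * tprod tau i.
  move=> g; have [a [c [aA /C_cyc[h [hP ->]] ->]]] := G_AC g.
  have [i iP] := choice (fun s => cyc_expgn (tau_order s) (hP s)).
  by exists i, a => //; congr (_ * _); apply: eq_bigr.
(* By condition (2), [psi s ^+ (p s ^ m s)] is the identity. *)
have A_cent s a : a \in A -> commute a (tau s ^+ (p s ^ m s)%N).
  move=> aA; apply/esym; have [o [[_ psio _] /dvdnP[w ->]]] := cond2 s.
  have := mulg_psiX (psi_def s) (w * o) (Sub a aA); rewrite !SubK => ->.
  by rewrite mulnC expgnA psio expg1n perm1E SubK.
have [e [[e0 Ae _] eco]] := cond1.
have A_exp a : a \in A -> a ^+ e = 1.
  move=> aA; have valX i : val (Sub a aA ^+ i : subgrp A) = a ^+ i.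
    by elim: i => [//|i IH]; rewrite !expgS -IH.
  by rewrite -valX Ae.
have Aut_tau theta s c z : theta \in Aut G -> c \in A ->
    theta (tau s) = c * tau s ^+ z -> z = 1 %[mod p s ^ (n s - m s)].
  move=> thetaA cA /(cond3 theta s c (Posz z) thetaA cA).
  rewrite !modz_nat => -[E].
  have dv : (p s ^ (n s - m s) %| p s ^ (n s - m s + eps (p s)))%N.
    by rewrite dvdn_exp2l // leq_addr.
  by rewrite -(modn_dvdm z dv) E modn_dvdm.
have piN : pi \in NHol G.
  exact: (pi_NHol tauC tau_order A_normal tprod_modA tprod_inj lP p_prime
    p_inj m_le_n A_cent pi_def A_exp eco Aut_tau).
exists piN => n_le; split.
- by rewrite prodn_gt0 // => s; rewrite expn_gt0 prime_gt0.
- apply: quot_inj; rewrite coset_expg.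
  by rewrite (pi_expg_order tau_order lP p_prime m_le_n pi_def m_pos n_le).
move=> x x0 /coset_expg_eq1 piH; apply: dvdn_leq => //.
exact: (dvdn_pi_order tau_order tprod_inj p_prime p_inj m_le_n pi_def m_pos
  p_ndvd_u n_le).
Qed.
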